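(* Let $S=R[a;\sigma_1,\delta_1][d;\sigma_2,\delta_2]$ be an involutive skew polynomial extension (ISPE) of a ring $R$, put $u=d-a$, and suppose the following conditions hold: (1) $R$ is affine and commutative with generators $r_1,\dots,r_n$, and $\sigma_1=\mathrm{id}_R$; (2) $u$ is normal in $S$; (3) $r_i^{-1}\delta_1(r_i)=r_j^{-1}\delta_1(r_j)$ for all $i,j\in\{1,\dots,n\}$; (4) $a(r_i^{-1}u)=(r_i^{-1}u)a$ (for each generator $r_i$). Then $S$ is birationally equivalent to $A_1(R)$, the first Weyl algebra over $R$.
   Context: $\Bbbk$ is an algebraically closed field of characteristic zero and all algebras are $\Bbbk$-algebras. For an automorphism $\sigma$ of $R$, a $\sigma$-derivation is a $\Bbbk$-linear map $\delta:R\to R$ with $\delta(rs)=\sigma(r)\delta(s)+\delta(r)s$; the skew polynomial ring $R[x;\sigma,\delta]$ has commutation rule $xr=\sigma(r)x+\delta(r)$ for $r\in R$. An involutive skew polynomial extension (ISPE) of $R$ is an iterated skew polynomial ring $S=R[a;\sigma_1,\delta_1][d;\sigma_2,\delta_2]$ (with $\sigma_2,\delta_2$ defined on $R[a;\sigma_1,\delta_1]$) for which there is an involution $\tau\in\mathrm{Aut}(S)$ with $\tau(a)=d$, $\tau(d)=a$ and $\tau(r)=r$ for all $r\in R$. An element $u$ of $S$ is normal if $uS=Su$. Inverses $r_i^{-1}$ are taken in the classical quotient ring of $S$. $A_1(R)$ is the overring of $R$ with additional generators $x,y$ that commute with $R$ and satisfy $xy=yx+1$. Two rings are birationally equivalent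 if their classical quotient rings are isomorphic (as $\Bbbk$-algebras).
   Formalization: The formal theorem adds that δ_1(r_i) is regular (not a zero divisor) in R for some i; without this the claim fails, e.g. for R = k[r], δ_1 = 0 and S = k[r,a,d] commutative, where all four conditions hold. *)

(* Defs.v *)
From HB Require Import structures.
From mathcomp Require Import all_boot all_order all_algebra.

Set Implicit Arguments.
Unset Strict Implicit.
Unset Printing Implicit Defensive.

Import GRing.Theory.
Local Open Scope ring_scope.

(** The [k]-subalgebra generated by a subset [X] of [A]. *)
Inductive subalg_gen (k : fieldType) (A : algType k) (X : A -> Prop) :
    A -> Prop :=
  | subalg_gen_in z : X z -> subalg_gen X z
  | subalg_gen_scalar (c : k) : subalg_gen X c%:A
  | subalg_genD y z : subalg_gen X y -> subalg_gen X z -> subalg_gen X (y + z)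
  | subalg_genM y z : subalg_gen X y -> subalg_gen X z -> subalg_gen X (y * z).

Definition generated_by (k : fieldType) (A : algType k) (X : A -> Prop) : Prop :=
  forall z : A, subalg_gen X z.

Definition is_sigma_derivation (k : fieldType) (R : algType k)
    (sigma : {lrmorphism R -> R}) (delta : {linear R -> R}) : Prop :=
  forall r s : R, delta (r * s) = sigma r * delta s + delta r * s.

(** [S] is the skew polynomial ring [R[x; sigma, delta]], with [R] embedded in
    [S] by [iota]. The last clause says that [S] is a free left [R]-module on
    the powers of [x]: by [horner_coef], [(map_poly iota p).[x]] is
    [\sum_i iota p`_i * x ^+ i], with coefficients on the left. Injectivity of
    [iota] follows (constant polynomials). *)
Definition is_skew_poly_ring (k : fieldType) (R S : algType k)
    (sigma : {lrmorphism R -> R}) (delta : {linear R -> R})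
    (iota : {lrmorphism R -> S}) (x : S) : Prop :=
  [/\ bijective sigma,
      is_sigma_derivation sigma delta,
      forall r : R, x * iota r = iota (sigma r) * x + iota (delta r)
    & bijective (fun p : {poly R} => (map_poly iota p).[x])].

(** [S = R[a; sigma1, delta1][d; sigma2, delta2]], where [T] is the
    intermediate ring [R[a; sigma1, delta1]]. *)
Definition is_ISPE (k : fieldType) (R T S : algType k)
    (sigma1 : {lrmorphism R -> R}) (delta1 : {linear R -> R})
    (iota1 : {lrmorphism R -> T}) (a : T)
    (sigma2 : {lrmorphism T -> T}) (delta2 : {linear T -> T})
    (iota2 : {lrmorphism T -> S}) (d : S) : Prop :=
  [/\ is_skew_poly_ring sigma1 delta1 iota1 a,
      is_skew_poly_ring sigma2 delta2 iota2 d
    & exists tau : {lrmorphism S -> S},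
        [/\ involutive tau, tau (iota2 a) = d, tau d = iota2 a
          & forall r : R, tau (iota2 (iota1 r)) = iota2 (iota1 r)]].

(** [u S = S u] *)
Definition is_normal_elt (k : fieldType) (S : algType k) (u : S) : Prop :=
  (forall s : S, exists t : S, u * s = t * u) /\
  (forall s : S, exists t : S, s * u = u * t).

Definition is_regular (k : fieldType) (S : algType k) (s : S) : Prop :=
  GRing.lreg s /\ GRing.rreg s.

(** [Q] is a (two-sided) classical ring of quotients of [S], via [j]. *)
Definition is_classical_quotient_ring (k : fieldType) (S : algType k)
    (Q : unitAlgType k) (j : {lrmorphism S -> Q}) : Prop :=
  [/\ injective j,
      forall s : S, is_regular s -> j s \is a GRing.unit,
      forall q : Q, exists s t : S, is_regular t /\ q = j s / j t
    & forall q : Q, exists s t : S, is_regular t /\ q = (j t)^-1 * j s].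

Definition birationally_equivalent (k : fieldType) (S A : algType k) : Prop :=
  exists (QS QA : unitAlgType k)
         (jS : {lrmorphism S -> QS}) (jA : {lrmorphism A -> QA})
         (f : {lrmorphism QS -> QA}),
    [/\ is_classical_quotient_ring jS, is_classical_quotient_ring jA
      & bijective f].

(** [A] is the overring [A_1(R)] of [R] (embedded by [iota]) presented by
    generators [x, y] and the relations that [x] and [y] commute with [R] and
    [x y = y x + 1]. The last clause says that these are defining relations;
    uniqueness of [f] there follows from generation. *)
Definition is_first_weyl_algebra (k : fieldType) (R A : algType k)
    (iota : {lrmorphism R -> A}) (x y : A) : Prop :=
  let relations (B : algType k) (h : R -> B) (X Y : B) :=
    [/\ forall r : R, X * h r = h r * X,
        forall r : R, Y * h r = h r * Y
      & X * Y = Y * X + 1] in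
  [/\ injective iota,
      generated_by (fun z : A => (exists r : R, z = iota r) \/ z = x \/ z = y),
      relations A iota x y
    & forall (B : algType k) (h : {lrmorphism R -> B}) (X Y : B),
        relations B h X Y ->
        exists f : {lrmorphism A -> B},
          [/\ forall r : R, f (iota r) = h r, f x = X & f y = Y]].

(* Main.v *)
Require Import Defs.
From HB Require Import structures.
From mathcomp Require Import all_boot all_order all_algebra.
Import GRing.Theory.
Local Open Scope ring_scope.

(** Write [u = d - a]. Applying the involution to [a s = s a + delta1 s] gives
    [d s = s d + delta1 s], so [u] commutes with [R]. Hypothesis [h4], cleared of
    denominators, reads [r_i (a u - u a) = delta1 (r_i) u]. Comparing the
    coefficients of [d] on both sides shows that the constant coefficient [c] of
    [a - sigma2 a], an element of [R], satisfies [delta1 (r_i) = c r_i]; by [h3]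
    it is enough to know this for one [i]. As [r_i] is a unit of [Q], also
    [a u - u a = c u]. Hence
    [[
      a r_i = r_i (a + c),      a u = u (a + c),
    ]]
    and [c] and [u], being regular in [S], are units of its quotient ring [Q]:
    [c] because [c r_i = delta1 (r_i)] is regular for some [i], [u] because it is
    monic of degree one in [d]. The elements [r_i u^-1] therefore commute with
    [a] and [u], while [X = u^-1 c^-1 a] and [Y = u] satisfy [X Y = Y X + 1].

    To turn this into a homomorphism [Phi] from [A_1(R)] to [Q], one needs a
    homomorphism [phi] from [R] to [Q] with [phi (r_i) = r_i u^-1]. It exists
    because [R] is graded with all [r_i] of degree one: the derivation [delta1]
    multiplies a product of [m] generators by [m c], and in characteristic zero
    these eigenspaces are independent, so [phi] may send an element [s] of
    degree [m] to [s u^-m] (lemma [homogenization]).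

    [Phi] is injective as soon as [phi] is, because taking commutators with
    [x] and [y] brings a nonzero element of an ideal of [A_1(R)] down to a
    nonzero element of [R] (lemma [weyl_hom_inj]); and [phi] is injective
    because the powers of [u], monic in [d], are independent over [R] (lemma
    [horner_subX_eq0]). The image of [Phi] contains [r_i = (r_i u^-1) u],
    [a = c u X] and [d = a + u], hence all of [S]. A ring between [S] and [Q] has
    [Q] as its quotient ring too (lemma [intermediate_order]), so [A_1(R)] and
    [S] share the quotient ring [Q]. *)

(** * Preliminaries *)

Lemma poly_split {R : nzRingType} {n : nat} {p : {poly R}} : (size p <= n.+1)%N ->
  p = (p`_n)%:P * 'X^n + \poly_(i < n) p`_i.
Proof.
move=> sp; apply/polyP => i; rewrite coefD coefCM coefXn coef_poly.
case: (ltngtP i n) => [_|lt_ni|->]; rewrite ?mulr1 ?mulr0 ?add0r ?addr0 //.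
by rewrite nth_default // (leq_trans sp).
Qed.

Lemma horner_reciprocal (B : unitRingType) (n : nat) (p : {poly B}) (u : B) :
  u \is a GRing.unit -> (size p <= n.+1)%N ->
  (\poly_(i < n.+1) p`_(n - i)).[u] = p.[u^-1] * u ^+ n.
Proof.
move=> uU sp; rewrite horner_poly (horner_coef_wide _ sp) mulr_suml.
rewrite (reindex_inj rev_ord_inj); apply: eq_bigr => i _ /=.
have lein : (i <= n)%N by rewrite -ltnS.
by rewrite subSS subKn // -mulrA exprVn -[in u ^+ n](subnKC lein) exprD mulKr ?unitrX.
Qed.

(** Reversing the coefficients turns polynomials in [u^-1] into polynomials in
    [u], up to a power of [u]. *)
Lemma horner_invr_eq0 {R : nzRingType} {B : unitRingType} {e : {rmorphism R -> B}}
    {u : B} {p : {poly R}} :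
  u \is a GRing.unit ->
  (forall q : {poly R}, (map_poly e q).[u] = 0 -> q = 0) ->
  (map_poly e p).[u^-1] = 0 -> p = 0.
Proof.
move=> uU indep p0; pose q := \poly_(i < (size p).+1) p`_(size p - i).
have q0 : q = 0.
  apply: indep.
  transitivity (\poly_(i < (size p).+1) (map_poly e p)`_(size p - i)).[u].
    congr (_.[_]); apply/polyP => i; rewrite coef_map [q`_i]coef_poly coef_poly.
    by case: ifP => _; [rewrite coef_map | apply: rmorph0].
  by rewrite horner_reciprocal // ?p0 ?mul0r // (leq_trans (size_poly _ _)).
apply/polyP => i; rewrite coef0; case: (ltnP i (size p)) => [ip|]; last exact: nth_default.
move/(congr1 (fun f : {poly R} => f`_(size p - i))): q0; rewrite coef0 coef_poly.
by rewrite ltnS leq_subr subKn // ltnW.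
Qed.

Lemma comm_lrmorphism {k : fieldType} {R B : algType k} {f : {lrmorphism R -> B}}
    {G : R -> Prop} {z : B} : generated_by G -> (forall g, G g -> GRing.comm z (f g)) ->
  forall s, GRing.comm z (f s).
Proof.
move=> genG Gz s; elim: (genG s) => {s} [//|c|s t _ IHs _ IHt|s t _ IHs _ IHt].
- by rewrite rmorph_alg /GRing.comm mulr_algl mulr_algr.
- by rewrite rmorphD; apply: commrD.
- by rewrite rmorphM; apply: commrM.
Qed.

Section Preliminaries.
Set Implicit Arguments.
Unset Strict Implicit.

Lemma mulrn_eq0_char0 (k : fieldType) (V : lmodType k) (v : V) (n : nat) :
  [pchar k] =i pred0 -> v *+ n.+1 = 0 -> v = 0.
Proof.
move=> /pcharf0P k0; rewrite -scaler_nat => /(congr1 ( *:%R n.+1%:R^-1)).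
by rewrite scaler0 scalerA mulVf ?scale1r // k0.
Qed.

Lemma lrmorphism_of (k : fieldType) (R B : algType k) (f : R -> B) :
  (forall r s, f (r + s) = f r + f s) -> (forall r s, f (r * s) = f r * f s) ->
  (forall c : k, f c%:A = c%:A) -> exists g : {lrmorphism R -> B}, g =1 f.
Proof.
move=> fD fM fA.
have fB : zmod_morphism f by move=> r s; apply: (addIr (f s)); rewrite -fD !subrK.
have f1 : monoid_morphism f by split=> //; rewrite -(scale1r 1) fA scale1r.
have fZ : scalable f by move=> c r; rewrite -mulr_algl fM fA mulr_algl.
pose fa := GRing.isZmodMorphism.Build R B f fB.
pose fm := GRing.isMonoidMorphism.Build R B f f1.
pose fs := GRing.isScalable.Build k R B *:%R f fZ.
by exists (HB.pack f fa fm fs : {lrmorphism R -> B}).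
Qed.

End Preliminaries.

(** * Skew polynomial rings: leading terms *)

Section SkewPolynomials.
Set Implicit Arguments.
Unset Strict Implicit.

Variables (k : fieldType) (R S : algType k).
Variables (sigma : {lrmorphism R -> R}) (delta : {linear R -> R}).
Variables (iota : {lrmorphism R -> S}) (x : S).
Hypothesis skewS : is_skew_poly_ring sigma delta iota x.

(** A strict bound, so that the induction on [n] starts from the zero element
    and zero needs no separate degree. *)
Definition deg_lt (n : nat) (s : S) : Prop :=
  exists p : {poly R}, (size p <= n)%N /\ s = (map_poly iota p).[x].

Lemma deg_lt_zero (n : nat) : deg_lt n 0.
Proof. by exists 0; rewrite size_poly0 rmorph0 horner0. Qed.

Lemma skew_commute (r : R) : x * iota r = iota (sigma r) * x + iota (delta r).
Proof. by case: skewS. Qed.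

Lemma skew_sigma_inj : injective sigma.
Proof. by case: skewS => /bij_inj. Qed.

Lemma deg_lt_exists (s : S) : exists n, deg_lt n s.
Proof.
case: skewS => _ _ _ [f _ fK].
by exists (size (f s)), (f s); split=> //; rewrite -[LHS]fK.
Qed.

Lemma deg_ltW (m n : nat) (s : S) : (m <= n)%N -> deg_lt m s -> deg_lt n s.
Proof. by move=> mn [p [sp ->]]; exists p; rewrite (leq_trans sp). Qed.

Lemma deg_ltD (n : nat) (s t : S) : deg_lt n s -> deg_lt n t -> deg_lt n (s + t).
Proof.
move=> [p [sp ->]] [q [sq ->]]; exists (p + q); rewrite rmorphD hornerD; split=> //.
by rewrite (leq_trans (size_polyD p q)) // geq_max sp.
Qed.

Lemma deg_ltN (n : nat) (s : S) : deg_lt n s -> deg_lt n (- s).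
Proof. by move=> [p [sp ->]]; exists (- p); rewrite size_polyN rmorphN hornerN. Qed.

Lemma deg_lt_monomial (n : nat) (r : R) : deg_lt n.+1 (iota r * x ^+ n).
Proof.
exists (r%:P * 'X^n); split.
  rewrite mul_polyC (leq_trans (size_scale_leq _ _)) // size_polyXn //.
by rewrite rmorphM /= map_polyC map_polyXn hornerCM hornerXn.
Qed.

Lemma deg_lt0 (s : S) : deg_lt 0 s -> s = 0.
Proof. by move=> [p [+ ->]]; rewrite leqn0 size_poly_eq0 => /eqP->; rewrite rmorph0 horner0. Qed.

Lemma deg_ltS (n : nat) (s : S) : deg_lt n.+1 s ->
  exists r s', deg_lt n s' /\ s = iota r * x ^+ n + s'.
Proof.
move=> [p [sp ->]]; exists p`_n, (map_poly iota (\poly_(i < n) p`_i)).[x]; split.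
  by exists (\poly_(i < n) p`_i); rewrite size_poly.
rewrite {1}(poly_split sp) rmorphD hornerD rmorphM /= map_polyC map_polyXn.
by rewrite hornerCM hornerXn.
Qed.

Lemma lead_eq0 (n : nat) (r : R) (s : S) :
  deg_lt n s -> iota r * x ^+ n + s = 0 -> r = 0.
Proof.
move=> [p [sp ->]]; case: skewS => _ _ _ [f fK _] eq0.
have: r%:P * 'X^n + p = 0.
  rewrite -[LHS]fK -[RHS]fK; congr f.
  rewrite rmorph0 horner0 -[RHS]eq0 rmorphD rmorphM /= map_polyC map_polyXn.
  by rewrite hornerD hornerCM hornerXn.
move/(congr1 (fun q : {poly R} => q`_n)).
by rewrite coefD coefCM coefXn eqxx mulr1 coef0 nth_default ?addr0.
Qed.

Lemma skew_const_eq0 (r : R) : iota r = 0 -> r = 0.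
Proof.
move=> r0; apply: (lead_eq0 (deg_lt_zero 0)).
by rewrite r0 mul0r addr0.
Qed.

Lemma deg_lt_scale (n : nat) (r : R) (s : S) : deg_lt n s -> deg_lt n (iota r * s).
Proof.
move=> [p [sp ->]]; exists (r%:P * p); rewrite rmorphM /= map_polyC hornerCM; split=> //.
by rewrite mul_polyC (leq_trans (size_scale_leq _ _)).
Qed.

Lemma deg_ltMx (n : nat) (s : S) : deg_lt n s -> deg_lt n.+1 (s * x).
Proof.
move=> [p [sp ->]]; exists (p * 'X); rewrite rmorphM /= map_polyX hornerMX; split=> //.
by rewrite (leq_trans (size_polyMleq _ _)) // size_polyX addn2.
Qed.

Lemma deg_ltxM (n : nat) (s : S) : deg_lt n s -> deg_lt n.+1 (x * s).
Proof.
elim: n s => [|n IHn] s => [/deg_lt0->|/deg_ltS[r [t [/IHn tn ->]]]].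
  by rewrite mulr0; apply: deg_lt_zero.
rewrite mulrDr mulrA skew_commute mulrDl -mulrA -exprS; apply: deg_ltD.
  by apply: deg_ltD (deg_lt_monomial _ _) (deg_ltW _ (deg_lt_monomial _ _)).
exact: deg_ltW tn.
Qed.

(** Moving [x ^ n] past a coefficient twists it by [sigma ^ n] in degree [n];
    [delta] contributes in lower degrees only. *)
Lemma deg_lt_expr_commute (n : nat) (r : R) :
  deg_lt n (x ^+ n * iota r - iota (iter n sigma r) * x ^+ n).
Proof.
elim: n => [|n /deg_ltxM IHn]; first by rewrite mul1r mulr1 subrr; apply: deg_lt_zero.
have -> : x ^+ n.+1 * iota r - iota (iter n.+1 sigma r) * x ^+ n.+1 =
  x * (x ^+ n * iota r - iota (iter n sigma r) * x ^+ n) +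
  iota (delta (iter n sigma r)) * x ^+ n.
  by rewrite mulrBr !mulrA skew_commute mulrDl -exprS -mulrA -exprS /= opprD addrA addrNK.
exact: deg_ltD (deg_lt_monomial _ _).
Qed.

Lemma deg_ltMscale (n : nat) (r : R) (s : S) : deg_lt n s -> deg_lt n (s * iota r).
Proof.
elim: n s => [|n IHn] s => [/deg_lt0->|/deg_ltS[t [s' [/IHn tn ->]]]].
  by rewrite mul0r; apply: deg_lt_zero.
rewrite mulrDl; apply: deg_ltD (deg_ltW _ tn) => //.
rewrite -mulrA; apply: deg_lt_scale.
rewrite -[_ * _](subrK (iota (iter n sigma r) * x ^+ n)).
exact: deg_ltD (deg_ltW _ (deg_lt_expr_commute _ _)) (deg_lt_monomial _ _).
Qed.

(** If the vanishing of [f s] always forces the leading coefficient of [s] to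
    vanish, the terms of [s] disappear one by one, from the top. It serves for
    left and right multiplications by an element whose leading coefficient is
    regular. *)
Lemma lead_inj (f : S -> S) :
  (forall n r s, deg_lt n s -> f (iota r * x ^+ n + s) = 0 -> r = 0) ->
  forall s, f s = 0 -> s = 0.
Proof.
move=> flead s; have [n] := deg_lt_exists s.
elim: n s => [|n IHn] s => [/deg_lt0//|/deg_ltS[r [t [tn ->]]] fst].
move: (fst); rewrite (flead _ _ _ tn fst) rmorph0 mul0r add0r; exact: IHn.
Qed.

(** On the leading coefficient [t] of degree [n], left multiplication by [r] acts
    as [r * t] and right multiplication as [t * sigma ^ n r]; the latter is
    harmless because [sigma] is bijective. *)
Lemma skew_regular_const (r : R) : is_regular r -> is_regular (iota r).
Proof.
case=> regl regr; split.
  apply: mulrI0_lreg; apply: (@lead_inj ( *%R (iota r))) => n t s sn.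
  rewrite /= mulrDr mulrA -rmorphM => /(lead_eq0 (deg_lt_scale r sn))/eqP.
  by rewrite mulrI_eq0 // => /eqP.
apply: mulIr0_rreg; apply: (@lead_inj ( *%R^~ (iota r))) => n t s sn /= eq0.
have: t * iter n sigma r = 0.
  apply: (@lead_eq0 n _ (iota t * (x ^+ n * iota r - iota (iter n sigma r) * x ^+ n) + s * iota r)).
    exact: deg_ltD (deg_lt_scale _ (deg_lt_expr_commute _ _)) (deg_ltMscale _ sn).
  by rewrite -[RHS]eq0 mulrBr addrA mulrDl rmorphM !mulrA; congr (_ + _); rewrite addrC subrK.
(* [t] is itself of the form [sigma ^ n v], and then [sigma ^ n (v * r) = 0]. *)
case: skewS => -[g sK gK] _ _ _.
have iterK : cancel (iter n sigma) (iter n g).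
  by elim: (n) => // m IHm z; rewrite iterSr iterS sK IHm.
have iterK' : cancel (iter n g) (iter n sigma).
  by elim: (n) => // m IHm z; rewrite iterSr iterS gK IHm.
have iterM y z : iter n sigma (y * z) = iter n sigma y * iter n sigma z.
  by elim: (n) => //= m ->; rewrite rmorphM.
have iter0 : iter n sigma 0 = 0 by elim: (n) => //= m ->; rewrite rmorph0.
rewrite -[t]iterK' -iterM -[RHS]iter0 => /(can_inj iterK)/eqP.
by rewrite mulIr_eq0 // => /eqP->.
Qed.

(** Multiplication by [x - t] raises the degree by one and keeps the leading
    coefficient, up to [sigma] on the left. *)
Lemma skew_regular_subX (t : R) : is_regular (x - iota t).
Proof.
split.
  apply: mulrI0_lreg; apply: (@lead_inj ( *%R (x - iota t))) => n r s sn /= eq0.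
  apply: skew_sigma_inj; rewrite rmorph0.
  apply: (@lead_eq0 n.+1 _ (iota (delta r) * x ^+ n + x * s - iota t * (iota r * x ^+ n + s))).
    apply: deg_ltD; last apply: deg_ltN.
      exact: deg_ltD (deg_lt_monomial _ _) (deg_ltxM sn).
    by apply: deg_lt_scale (deg_ltD (deg_lt_monomial _ _) (deg_ltW _ sn)).
  rewrite -[RHS]eq0 mulrBl addrA; congr (_ - _).
  by rewrite mulrDr mulrA skew_commute mulrDl -mulrA -exprS addrA.
apply: mulIr0_rreg; apply: (@lead_inj ( *%R^~ (x - iota t))) => n r s sn /= eq0.
apply: (@lead_eq0 n.+1 _ (s * x - (iota r * x ^+ n + s) * iota t)).
  apply: deg_ltD (deg_ltMx sn) (deg_ltN (deg_ltMscale _ _)).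
  exact: deg_ltD (deg_lt_monomial _ _) (deg_ltW _ sn).
by rewrite -[RHS]eq0 mulrBr addrA exprSr mulrA -mulrDl.
Qed.

Lemma deg_lt_subX_expr (t : R) (n : nat) : deg_lt n ((x - iota t) ^+ n - x ^+ n).
Proof.
elim: n => [|n IHn]; first by rewrite subrr; apply: deg_lt_zero.
have -> : (x - iota t) ^+ n.+1 - x ^+ n.+1 =
   x * ((x - iota t) ^+ n - x ^+ n) - iota t * (((x - iota t) ^+ n - x ^+ n) + iota 1 * x ^+ n).
  by rewrite rmorph1 mul1r subrK !exprS mulrBl mulrBr addrAC.
apply: deg_ltD (deg_ltxM IHn) (deg_ltN (deg_lt_scale _ _)).
exact: deg_ltD (deg_ltW _ IHn) (deg_lt_monomial _ _).
Qed.

(** The transition from the powers of [x] to those of [x - t] is unitriangular,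
    so independence carries over. *)
Lemma horner_subX_eq0 (t : R) (p : {poly R}) : (map_poly iota p).[x - iota t] = 0 -> p = 0.
Proof.
have subX_lt m (q : {poly R}) : (size q <= m)%N -> deg_lt m (map_poly iota q).[x - iota t].
  elim: m q => [q|m IHm q sq].
    by rewrite leqn0 size_poly_eq0 => /eqP->; rewrite rmorph0 horner0; apply: deg_lt_zero.
  rewrite (poly_split sq) rmorphD hornerD; apply: deg_ltD (deg_ltW _ (IHm _ (size_poly _ _))) => //.
  rewrite rmorphM /= map_polyC map_polyXn hornerCM hornerXn; apply: deg_lt_scale.
  rewrite -[_ ^+ m](subrK (x ^+ m)) -[X in _ + X]mul1r -(rmorph1 iota).
  exact: deg_ltD (deg_ltW _ (deg_lt_subX_expr _ _)) (deg_lt_monomial _ _).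
have [n] := ubnP (size p); elim: n p => // n IHn p; rewrite ltnS; case: n => [|n] in IHn *.
  by rewrite leqn0 size_poly_eq0 => /eqP.
move=> sp p0; suff pn0: p`_n = 0.
  apply: IHn => //; rewrite ltnS; apply/leq_sizeP => i; rewrite leq_eqVlt => /predU1P[<- //|].
  by apply/leq_sizeP.
apply: (@lead_eq0 n _ (iota p`_n * ((x - iota t) ^+ n - x ^+ n) +
                       (map_poly iota (\poly_(i < n) p`_i)).[x - iota t])).
  exact: deg_ltD (deg_lt_scale _ (deg_lt_subX_expr _ _)) (subX_lt _ _ (size_poly _ _)).
rewrite -[RHS]p0 [in RHS](poly_split sp) rmorphD hornerD addrA -mulrDr [x ^+ n + _]addrC subrK.
by rewrite rmorphM /= map_polyC map_polyXn hornerCM hornerXn.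
Qed.

Lemma skew_poly_ind (P : S -> Prop) :
  (forall s t, P s -> P t -> P (s + t)) -> (forall s t, P s -> P t -> P (s * t)) ->
  (forall r, P (iota r)) -> P x -> forall s, P s.
Proof.
move=> PD PM Piota Px s; case: skewS => _ _ _ [f _ fK]; rewrite -[s]fK.
elim/poly_ind: (f s) => [|p r IHp]; first by have := Piota 0; rewrite !rmorph0 horner0.
rewrite rmorphD rmorphM /= map_polyX map_polyC hornerMXaddC.
by apply: PD; [apply: PM|apply: Piota].
Qed.

End SkewPolynomials.

(** * Weyl algebras *)

Section Weyl.
Set Implicit Arguments.
Unset Strict Implicit.

(** The commutator with [Y] is a derivation that kills the coefficients and sends
    [X] to [1]. *)
Lemma deriv_horner_weyl (B : nzRingType) (X Y : B) (p : {poly B}) :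
  X * Y = Y * X + 1 -> (forall i, p`_i * Y = Y * p`_i) ->
  (p^`()).[X] = p.[X] * Y - Y * p.[X].
Proof.
move=> XY; elim/poly_ind: p => [|p c IHp] pY; first by rewrite deriv0 !horner0 mulr0 mul0r subrr.
have cY : c * Y = Y * c.
  by have := pY 0; rewrite coefD coefMX coefC !eqxx add0r.
have {}IHp : (p^`()).[X] = p.[X] * Y - Y * p.[X].
  by apply: IHp => i; have := pY i.+1; rewrite coefD coefMX coefC /= addr0.
rewrite derivMXaddC hornerD hornerMX hornerMXaddC IHp.
have -> : (p.[X] * X + c) * Y = p.[X] * Y * X + p.[X] + Y * c.
  by rewrite mulrDl -mulrA XY mulrDr mulr1 mulrA cY.
by rewrite mulrBl mulrDr mulrA opprD addrACA subrr addr0 addrAC addrC.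
Qed.

(** The derivative of a vanishing polynomial in [X] vanishes too, being a
    commutator; by induction on the degree it is the zero polynomial, so [p] is
    constant by characteristic zero. *)
Lemma horner_weyl_eq0 (k : fieldType) (B : algType k) (X Y : B) (p : {poly B}) :
  [pchar k] =i pred0 -> X * Y = Y * X + 1 -> (forall i, p`_i * Y = Y * p`_i) ->
  p.[X] = 0 -> p = 0.
Proof.
move=> k0 XY; have [n] := ubnP (size p); elim: n p => // n IHn p sp pY pX.
have dp0 : p^`() = 0.
  have [->|p0] := eqVneq p 0; first exact: deriv0.
  apply: IHn => [|i|]; first exact: leq_trans (lt_size_deriv p0) _.
    by rewrite coef_deriv mulrnAl mulrnAr pY.
  by rewrite (deriv_horner_weyl XY pY) pX mulr0 mul0r subrr.
have pC : p = (p`_0)%:P.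
  apply/polyP=> -[|i]; rewrite coefC //=.
  by apply: (mulrn_eq0_char0 k0 (n := i)); rewrite -coef_deriv dp0 coef0.
by rewrite pC; move: pX; rewrite {1}pC hornerC => ->; rewrite polyC0.
Qed.

(** Every element is a combination of words in the generators, built by adding
    one letter at a time on the left. *)
Lemma subalg_gen_ind_left (k : fieldType) (A : algType k) (G N : A -> Prop) :
  N 1 -> (forall v w, N v -> N w -> N (v + w)) ->
  (forall (c : k) w, N w -> N (c%:A * w)) ->
  (forall z w, G z -> N w -> N (z * w)) ->
  generated_by G -> forall w, N w.
Proof.
move=> N1 ND NA NG genG z; suff H w : N w -> N (z * w) by rewrite -[z]mulr1; apply: H.
elim: (genG z) w => {z} [z Gz w|c w|y z _ IHy _ IHz w Nw|y z _ IHy _ IHz w Nw].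
- exact: NG.
- exact: NA.
- by rewrite mulrDl; apply: ND; auto.
- by rewrite -mulrA; auto.
Qed.

(** Elements are written with coefficients from [R] on the left, then powers of
    [y], then powers of [x]: such sums are stable under left multiplication by the
    generators, since [x] passes a polynomial in [y] at the cost of its
    derivative. *)
Lemma weyl_normal_form (k : fieldType) (R A : algType k) (iota : {lrmorphism R -> A}) (x y : A) :
  is_first_weyl_algebra iota x y ->
  forall b : A, exists p : {poly A},
    (forall i, exists q : {poly R}, p`_i = (map_poly iota q).[y]) /\ b = p.[x].
Proof.
case=> _ genA [xR yR xy] _.
have iotaM r (p : {poly A}) : (forall i, exists q : {poly R}, p`_i = (map_poly iota q).[y]) ->
    exists p' : {poly A},
    (forall i, exists q : {poly R}, p'`_i = (map_poly iota q).[y]) /\ iota r * p.[x] = p'.[x].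
  move=> pP; exists ((iota r)%:P * p); split; last by rewrite hornerCM.
  move=> i; have [q pq] := pP i; exists (r%:P * q).
  by rewrite coefCM pq rmorphM /= map_polyC hornerCM.
apply: subalg_gen_ind_left genA => [|_ _ [p [pP ->]] [q [qP ->]]|c _ [p [pP ->]]|z w].
- exists 1; split=> [i|]; last by rewrite hornerC.
  exists (i == 0)%:R%:P; rewrite map_polyC hornerC /= rmorph_nat coef1 //.
- exists (p + q); split=> [i|]; last by rewrite hornerD.
  have [p' pE] := pP i; have [q' qE] := qP i.
  by exists (p' + q'); rewrite coefD pE qE rmorphD hornerD.
- have -> : c%:A = iota c%:A by rewrite rmorph_alg.
  exact: iotaM.
case=> [[r ->]|[->|->]] [p [pP ->]]; first exact: iotaM.
  (* x (sum_i p_i x^i) = sum_i (x p_i - p_i x) x^i + sum_i p_i x^(i+1) *)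
- exists (x%:P * p - p * x%:P + p * 'X); split=> [i|]; last first.
    have px : comm_poly x%:P x by rewrite /comm_poly hornerC.
    by rewrite !hornerE_comm (hornerM_comm _ px) hornerC subrK.
  have [q pq] := pP i.
  have [q' pq'] : exists q' : {poly R}, x * p`_i - p`_i * x = (map_poly iota q').[y].
    (* [y] and [- x] satisfy the Weyl relation, so this commutator is [q^`()] at [y]. *)
    exists q^`(); rewrite -deriv_map pq; set f := map_poly _ _.
    suff -> : (f^`()).[y] = f.[y] * (- x) - (- x) * f.[y].
      by rewrite mulrN mulNr opprK addrC.
    apply: deriv_horner_weyl => [|j]; first by rewrite mulrN mulNr xy opprD addrNK.
    by rewrite mulrN mulNr coef_map xR.
  have [q'' pq''] : exists q'' : {poly R}, (p * 'X)`_i = (map_poly iota q'').[y].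
    rewrite coefMX; case: ifP => _; last exact: pP.
    by exists 0; rewrite rmorph0 horner0.
  exists (q' + q''); rewrite coefD coefB coefCM coefMC pq' pq'' rmorphD hornerD //.
exists (y%:P * p); split; last by rewrite hornerCM.
move=> i; have [q pq] := pP i; exists (q * 'X).
rewrite coefCM pq rmorphM /= map_polyX hornerMX.
by apply: comm_coef_poly => j; rewrite coef_map yR.
Qed.

(** In [B] the images of the normal forms stay independent: first over the powers
    of [Phi x], whose coefficients commute with [Phi y], then over the powers of
    [Phi y], whose coefficients commute with [Phi x]. This is the fact that every
    nonzero ideal of a Weyl algebra over [R] meets [R]. *)
Lemma weyl_hom_inj (k : fieldType) (R A B : algType k)
    (iota : {lrmorphism R -> A}) (x y : A) (Phi : {lrmorphism A -> B}) :
  [pchar k] =i pred0 -> is_first_weyl_algebra iota x y ->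
  (forall r, Phi (iota r) = 0 -> r = 0) -> forall b, Phi b = 0 -> b = 0.
Proof.
move=> k0 weylA Phi0 b; have [p [pP ->]] := weyl_normal_form weylA b.
case: weylA => _ _ [xR yR xy] _.
have XY : Phi x * Phi y = Phi y * Phi x + 1 by rewrite -!rmorphM xy rmorphD rmorph1.
rewrite -horner_map => /(horner_weyl_eq0 k0 XY) p0.
suff -> : p = 0 by rewrite horner0.
have {}p0 : map_poly Phi p = 0.
  apply: p0 => i; rewrite coef_map; have [q ->] := pP i.
  rewrite -!rmorphM; congr (Phi _); apply/esym; apply: comm_coef_poly => j.
  by rewrite coef_map yR.
apply/polyP=> i; rewrite coef0; have [q qE] := pP i; rewrite qE.
suff -> : q = 0 by rewrite rmorph0 horner0.
move/(congr1 (fun f : {poly B} => f`_i)): p0; rewrite coef0 coef_map qE /= -horner_map.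
have YX : Phi y * - Phi x = - Phi x * Phi y + 1 by rewrite mulrN mulNr XY opprD addrNK.
move/(horner_weyl_eq0 k0 YX) => q0; apply/polyP=> l; rewrite coef0.
apply: Phi0; rewrite -!coef_map q0 ?coef0 // => m.
by rewrite !coef_map mulrN mulNr -!rmorphM xR.
Qed.

End Weyl.

(** * Orders between a ring and its quotient ring *)

(** [A] is seen as a ring between [S] and [Q]. Fractions of elements of [S] are
    fractions of elements of [A]; and if [b] in [A] is regular, then so is the
    numerator [s = b t] of a fraction [b = s / t] over [S], whence [s] and [b] are
    units. *)
Lemma intermediate_order (k : fieldType) (S A : algType k) (Q : unitAlgType k)
    (jS : {lrmorphism S -> Q}) (jA : {lrmorphism A -> Q}) :
  is_classical_quotient_ring jS -> injective jA ->
  (forall s, exists b, jA b = jS s) -> is_classical_quotient_ring jA.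
Proof.
move=> [jSinj jSreg fracr fracl] jAinj sub.
have reg s b : is_regular s -> jA b = jS s -> is_regular b.
  move=> /jSreg sU bs; split.
    by move=> u v /(congr1 jA); rewrite !rmorphM /= bs => /(mulrI sU)/jAinj.
  by move=> u v /(congr1 jA); rewrite /= !rmorphM /= bs => /(mulIr sU)/jAinj.
have jS0 u : jS u = 0 -> u = 0 by rewrite -(rmorph0 jS) => /jSinj.
have jA0 b : jA b = 0 -> b = 0 by rewrite -(rmorph0 jA) => /jAinj.
split=> // [b [bl br]|q|q].
- have [s [t [treg bE]]] := fracr (jA b).
  have tU := jSreg _ treg; rewrite bE unitrMr ?unitrV //; apply: jSreg.
  have {}bE : jS s = jA b * jS t by rewrite bE divrK.
  split; [apply: mulrI0_lreg => u su0|apply: mulIr0_rreg => u us0].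
    have [v vE] := sub (t * u).
    have /jA0/eqP : jA (b * v) = 0.
      by rewrite rmorphM /= vE rmorphM /= mulrA -bE -rmorphM su0 rmorph0.
    rewrite mulrI_eq0 // => /eqP v0; apply/jS0/(mulrI tU).
    by rewrite mulr0 -rmorphM /= -vE v0 rmorph0.
  have [v vE] := sub u.
  have /jA0/eqP : jA (v * b) = 0.
    by apply: (mulIr tU); rewrite mul0r rmorphM /= vE -mulrA -bE -rmorphM us0 rmorph0.
  by rewrite mulIr_eq0 // => /eqP v0; apply: jS0; rewrite -vE v0 rmorph0.
- have [s [t [treg ->]]] := fracr q; have [[b bE] [b' b'E]] := (sub s, sub t).
  by exists b, b'; rewrite bE b'E; split=> //; apply: reg treg b'E.
have [s [t [treg ->]]] := fracl q; have [[b bE] [b' b'E]] := (sub s, sub t).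
by exists b, b'; rewrite bE b'E; split=> //; apply: reg treg b'E.
Qed.

(** * Homogenization along a derivation *)

Section Homogenization.
Set Implicit Arguments.
Unset Strict Implicit.

(** When [delta g = c g] for all generators [g], products of [m] generators are
    eigenvectors of eigenvalue [m c]. The section proves that [R] is graded by
    these eigenspaces. The grading is encoded by the isomorphism [p |-> p.[1]]
    from the ring of those [p] whose coefficient of degree [m] is homogeneous of
    degree [m]: the preimage of [s] lists the homogeneous parts of [s]. *)
Variables (k : fieldType) (R : comAlgType k) (delta : {linear R -> R}) (c : R).
Hypothesis k0 : [pchar k] =i pred0.
Hypothesis deltaM : forall r s : R, delta (r * s) = r * delta s + delta r * s.
Hypothesis creg : GRing.lreg c.

Definition homogeneous_coefs (p : {poly R}) : Prop :=
  forall i, delta p`_i = (c * p`_i) *+ i.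

Lemma homogeneous_coefsD (p q : {poly R}) :
  homogeneous_coefs p -> homogeneous_coefs q -> homogeneous_coefs (p + q).
Proof. by move=> hp hq i; rewrite coefD raddfD /= hp hq mulrDr mulrnDl. Qed.

Lemma homogeneous_coefsM (p q : {poly R}) :
  homogeneous_coefs p -> homogeneous_coefs q -> homogeneous_coefs (p * q).
Proof.
move=> hp hq i; rewrite coefM raddf_sum mulr_sumr -sumrMnl; apply: eq_bigr => j _ /=.
rewrite deltaM hp hq mulrnAr mulrnAl -mulrA mulrCA -mulrnDr.
by rewrite subnK // -ltnS.
Qed.

Lemma homogeneous_coefs_scalar (b : k) : homogeneous_coefs (b%:A)%:P.
Proof.
case=> [|i]; last by rewrite coefC linear0 mulr0 mul0rn.
suff d1 : delta 1 = 0 by rewrite coefC /= linearZ /= d1 scaler0.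
by apply: (addrI (delta 1)); rewrite -{3}(mulr1 1) deltaM mul1r mulr1 addr0.
Qed.

Lemma homogeneous_coefs_linear (g : R) :
  delta g = c * g -> homogeneous_coefs (g%:P * 'X).
Proof.
move=> dg [|[|i]]; first by rewrite coefMX linear0.
  by rewrite coefMX coefC /= dg.
by rewrite coefMX coefC /= linear0 mulr0 mul0rn.
Qed.

(** Eigenvectors for distinct eigenvalues are independent. If [p] has degree [m]
    and its coefficients add up to zero, then applying [delta] and cancelling [c]
    shows the same for [q = X p' - m p], of smaller degree; so [q = 0] by
    induction, and [p] reduces to its top term. *)
Lemma homogeneous_coefs_horner1_eq0 (p : {poly R}) :
  homogeneous_coefs p -> p.[1] = 0 -> p = 0.
Proof.
have [n] := ubnP (size p); elim: n p => // n IHn p; rewrite ltnS => sp hp p1.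
pose q := 'X * p^`() - p *+ n.-1.
have qE i : q`_i = p`_i *+ i - p`_i *+ n.-1.
  by rewrite coefB coefMn coefXM coef_deriv; case: i => [|i] //=.
have q0 : q = 0.
  case: n => [|n] in IHn sp q qE *.
    by move: sp; rewrite /q leqn0 size_poly_eq0 => /eqP->; rewrite deriv0 mulr0 mul0rn subrr.
  apply: IHn.
  - rewrite ltnS; apply/leq_sizeP => i; rewrite qE leq_eqVlt => /predU1P[<-|ni].
      by rewrite subrr.
    by rewrite nth_default ?mul0rn ?subrr // (leq_trans sp).
  - move=> i; rewrite qE raddfB !raddfMn /= hp mulrDr !mulrnAr mulrN mulrnDl !mulNrn.
    by congr (_ - _); rewrite -!mulrnA mulnC.
  apply: creg; rewrite mulr0 hornerD hornerN hornerMn p1 mul0rn subr0.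
  rewrite -[RHS](raddf0 delta) -p1 (horner_coef_wide _ sp) raddf_sum.
  rewrite (horner_coef_wide (n := n.+1)); last first.
    apply/leq_sizeP => i ni; rewrite coefXM coef_deriv; case: i ni => //= i ni.
    by rewrite nth_default ?mul0rn // (leq_trans sp).
  rewrite mulr_sumr; apply: eq_bigr => -[i _] _ /=; rewrite !expr1n !mulr1 hp -mulrnAr.
  by rewrite coefXM coef_deriv; case: i.
have pC i : i != n.-1 -> p`_i = 0.
  move=> ni; move/(congr1 (fun f : {poly R} => f`_i)): q0; rewrite qE coef0.
  case: (ltngtP i n.-1) ni => // lt_in _ /eqP; rewrite subr_eq0 => /eqP eq_mul.
    have : p`_i *+ (n.-1 - i).-1.+1 = 0.
      by rewrite prednK ?subn_gt0 // mulrnBr 1?ltnW // eq_mul subrr.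
    exact: mulrn_eq0_char0.
  have : p`_i *+ (i - n.-1).-1.+1 = 0.
    by rewrite prednK ?subn_gt0 // mulrnBr 1?ltnW // eq_mul subrr.
  exact: mulrn_eq0_char0.
have pE : p = p`_(n.-1) *: 'X^(n.-1).
  apply/polyP => i; rewrite coefZ coefXn; case: eqVneq => [->|/pC->]; rewrite ?mulr1 ?mulr0 //.
by move: p1; rewrite pE hornerZ hornerXn expr1n mulr1 => ->; rewrite scale0r.
Qed.

Lemma homogeneous_coefs_exists (G : R -> Prop) (s : R) :
  generated_by G -> (forall g, G g -> delta g = c * g) ->
  exists p, homogeneous_coefs p /\ p.[1] = s.
Proof.
move=> genG deltaG; elim: (genG s)
  => {s} [s /deltaG ds|b|s t _ [p [hp <-]] _ [q [hq <-]]|s t _ [p [hp <-]] _ [q [hq <-]]].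
- by exists (s%:P * 'X); rewrite hornerCM hornerX mulr1; split=> //;
  apply: homogeneous_coefs_linear.
- by exists (b%:A)%:P; rewrite hornerC; split=> //; apply: homogeneous_coefs_scalar.
- by exists (p + q); rewrite hornerD; split=> //; apply: homogeneous_coefsD.
- by exists (p * q); rewrite hornerM; split=> //; apply: homogeneous_coefsM.
Qed.

(** [phi] sends an element [s], homogeneous of degree [m], to [e s * v ^+ m]. The
    second clause expresses this for sums [p.[1]] of homogeneous parts, and gives
    access to the kernel of [phi]. *)
Lemma homogenization (G : R -> Prop) (B : algType k) (e : {lrmorphism R -> B}) (v : B) :
  generated_by G -> (forall g, G g -> delta g = c * g) ->
  (forall r, e r * v = v * e r) ->
  exists phi : {lrmorphism R -> B},
    (forall g, G g -> phi g = e g * v) /\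
    (forall r, exists p : {poly R}, p.[1] = r /\ phi r = (map_poly e p).[v]).
Proof.
move=> genG deltaG ev.
(* A boolean form of the property, so that the preimage can be chosen. *)
pose lift (r : R) (p : {poly R}) :=
  [forall i : 'I_(size p), delta p`_i == (c * p`_i) *+ i] && (p.[1] == r).
have liftP r p : lift r p <-> homogeneous_coefs p /\ p.[1] = r.
  split=> [/andP[/forallP hp /eqP]|[hp p1]]; last first.
    by apply/andP; split; [apply/forallP => i; rewrite hp|apply/eqP].
  split=> // i; case: (ltnP i (size p)) => [ip|pi]; first exact/eqP/(hp (Ordinal ip)).
  by rewrite nth_default // linear0 mulr0 mul0rn.
have lift_ex r : exists p, lift r p.
  by have [p pP] := homogeneous_coefs_exists r genG deltaG; exists p; apply/liftP.
pose h r := xchoose (lift_ex r).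
have hP r : homogeneous_coefs (h r) /\ (h r).[1] = r by apply/liftP/(xchooseP (lift_ex r)).
have h_uniq p : homogeneous_coefs p -> h p.[1] = p.
  move=> hp; have [hh h1] := hP p.[1]; apply/eqP; rewrite -subr_eq0; apply/eqP.
  apply: homogeneous_coefs_horner1_eq0; last by rewrite hornerD hornerN h1 subrr.
  by move=> i; rewrite coefB raddfB /= hp hh mulrBr mulrnBl.
have [||b|phi phiE] := @lrmorphism_of k R B (fun r => (map_poly e (h r)).[v]).
- move=> r s; have [[hr r1] [hs s1]] := (hP r, hP s).
  rewrite -[in LHS]r1 -[in LHS]s1 -hornerD h_uniq ?rmorphD ?hornerD //.
  exact: homogeneous_coefsD.
- move=> r s; have [[hr r1] [hs s1]] := (hP r, hP s).
  rewrite -[in LHS]r1 -[in LHS]s1 -hornerM h_uniq; last exact: homogeneous_coefsM.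
  rewrite rmorphM hornerM_comm //; apply: comm_coef_poly => i.
  by rewrite coef_map ev.
- have := h_uniq _ (homogeneous_coefs_scalar b); rewrite hornerC => ->.
  by rewrite map_polyC hornerC /= rmorph_alg.
exists phi; split=> [g Gg|r]; last by exists (h r); rewrite phiE; have [] := hP r.
have := h_uniq _ (homogeneous_coefs_linear (deltaG _ Gg)).
rewrite phiE hornerCM hornerX mulr1 => ->.
by rewrite rmorphM /= map_polyC map_polyX hornerCM hornerX.
Qed.

End Homogenization.

(** * The birational equivalence *)

Theorem proposition4p5
  (k : closedFieldType) (hk : [pchar k] =i pred0)
  (R : comAlgType k) (T S : algType k)
  (sigma1 : {lrmorphism R -> R}) (delta1 : {linear R -> R})
  (iota1 : {lrmorphism R -> T}) (a : T)
  (sigma2 : {lrmorphism T -> T}) (delta2 : {linear T -> T})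
  (iota2 : {lrmorphism T -> S}) (d : S)
  (hS : is_ISPE sigma1 delta1 iota1 a sigma2 delta2 iota2 d)
  (* the classical quotient ring of S, in which the inverses are taken *)
  (Q : unitAlgType k) (j : {lrmorphism S -> Q})
  (hQ : is_classical_quotient_ring j)
  (* (1) *)
  (n : nat) (r : 'I_n -> R)
  (hr : generated_by (fun z : R => exists i : 'I_n, z = r i))
  (hr_inv : forall i : 'I_n, j (iota2 (iota1 (r i))) \is a GRing.unit)
  (h1 : forall s : R, sigma1 s = s)
  (* non-degeneracy; for a domain R it says that delta1 is nonzero *)
  (hdelta : exists i : 'I_n, is_regular (delta1 (r i)))
  (* (2) *)
  (h2 : is_normal_elt (d - iota2 a))
  (* (3) *)
  (h3 : forall i i' : 'I_n,
     (j (iota2 (iota1 (r i))))^-1 * j (iota2 (iota1 (delta1 (r i)))) =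
     (j (iota2 (iota1 (r i'))))^-1 * j (iota2 (iota1 (delta1 (r i')))))
  (* (4) *)
  (h4 : forall i : 'I_n,
     j (iota2 a) * ((j (iota2 (iota1 (r i))))^-1 * j (d - iota2 a)) =
     ((j (iota2 (iota1 (r i))))^-1 * j (d - iota2 a)) * j (iota2 a))
  (A : algType k) (iota : {lrmorphism R -> A}) (x y : A)
  (hA : is_first_weyl_algebra iota x y) :
  birationally_equivalent S A.
Proof.
case: hS => skewT skewS [tau [_ tau_a tau_d tau_r]].
case: (hQ) => j_inj j_unit _ _; case: hdelta => i0 reg_i0.
have [J JE] : exists J : {lrmorphism R -> Q}, forall s, J s = j (iota2 (iota1 s)).
  by exists (j \o (iota2 \o iota1)).
have J_inj s : J s = 0 -> s = 0.
  move=> Js0; apply: (skew_const_eq0 skewT); apply: (skew_const_eq0 skewS).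
  by apply: j_inj; rewrite rmorph0 -JE.
have JC s t : J s * J t = J t * J s by rewrite -!rmorphM mulrC.
have rU i : J (r i) \is a GRing.unit by rewrite JE.
pose u := j (d - iota2 a); pose b := j (iota2 a).
have uU : u \is a GRing.unit by apply/j_unit/(skew_regular_subX skewS).
have deltaM s t : delta1 (s * t) = s * delta1 t + delta1 s * t.
  by case: skewT => _ -> _ _; rewrite h1.
have a_comm s :
  iota2 a * iota2 (iota1 s) = iota2 (iota1 s) * iota2 a + iota2 (iota1 (delta1 s)).
  by rewrite -rmorphM (skew_commute skewT) h1 rmorphD rmorphM.
(* The image of [a_comm] under the involution. *)
have d_comm s : d * iota2 (iota1 s) = iota2 (iota1 s) * d + iota2 (iota1 (delta1 s)).
  by rewrite -tau_a -[X in _ * X]tau_r -rmorphM a_comm rmorphD rmorphM /= !tau_r.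
have uJ s : u * J s = J s * u.
  rewrite JE -!(rmorphM j); congr (j _).
  by rewrite mulrBl mulrBr a_comm d_comm opprD addrACA subrr addr0.
have bJ s : b * J s = J s * b + J (delta1 s).
  by rewrite !JE -!(rmorphM j) -(rmorphD j) a_comm.
(* Hypothesis [h4] cleared of the inverse of [r i], using
   [r (a r^-1) = a - delta1 r * r^-1]. *)
have key i : J (r i) * (b * u - u * b) = J (delta1 (r i)) * u.
  have rV : J (r i) * (b * (J (r i))^-1) = b - J (delta1 (r i)) / J (r i).
    apply: (mulIr (rU i)); rewrite -!mulrA mulVr // mulr1 mulrBl bJ -mulrA mulVr //.
    by rewrite mulr1 addrK.
  have : J (r i) * (b * ((J (r i))^-1 * u)) = u * b.
    by move: (h4 i); rewrite -JE => ->; rewrite -!mulrA mulVKr.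
  rewrite [b * _]mulrA mulrA rV mulrBl => <-; rewrite opprB addrC subrK.
  by rewrite !mulrA JC mulrK.
have [c c_spec] : exists c : R, r i0 * c = delta1 (r i0).
  (* [W] writes [a u - u a] as a polynomial of degree one in [d]; [key] then equates
     the coefficients of [d] on both sides. *)
  have coef_d : iota1 (r i0) * (a - sigma2 a) = iota1 (delta1 (r i0)).
    apply/eqP; rewrite -subr_eq0; apply/eqP.
    apply: (lead_eq0 skewS (n := 1)
      (s := iota2 (iota1 (delta1 (r i0)) * a - iota1 (r i0) * delta2 a))).
      rewrite -[X in deg_lt _ _ _ X]mulr1 -(expr0 d); exact: deg_lt_monomial.
    have W : iota2 a * (d - iota2 a) - (d - iota2 a) * iota2 a =
             iota2 (a - sigma2 a) * d - iota2 (delta2 a).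
      rewrite mulrBr mulrBl opprB addrA subrK (skew_commute skewS) opprD addrA.
      by rewrite -mulrBl -rmorphB.
    have eqd : iota2 (iota1 (r i0)) * (iota2 a * (d - iota2 a) - (d - iota2 a) * iota2 a) =
          iota2 (iota1 (delta1 (r i0))) * (d - iota2 a).
      by apply: j_inj; have := key i0; rewrite !JE !rmorphM rmorphB !(rmorphM j).
    rewrite W !mulrBr mulrA -!rmorphM in eqd; rewrite expr1.
    rewrite !(rmorphB iota2) mulrBl addrACA [- _ - _]addrC addrACA.
    by rewrite eqd addrA subrK subrr.
  case: (skewT) => _ _ _ [f fK Kf]; pose p := f (a - sigma2 a).
  have rp : (r i0)%:P * p = (delta1 (r i0))%:P.
    apply: (can_inj fK).
    by rewrite rmorphM /= !map_polyC hornerCM hornerC Kf coef_d.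
  exists p`_0.
  by move/(congr1 (fun q : {poly R} => q`_0)): rp; rewrite coefCM coefC.
have delta_r i : delta1 (r i) = c * r i.
  apply/eqP; rewrite -subr_eq0; apply/eqP/J_inj; rewrite rmorphB /=.
  have := h3 i i0; rewrite -!JE -c_spec [J (_ * _)]rmorphM mulKr // => h3c.
  by rewrite -(mulVKr (rU i) (J (delta1 (r i)))) h3c mulrC rmorphM subrr.
have ub : b * u - u * b = J c * u.
  by apply: (mulrI (rU i0)); rewrite key mulrA -rmorphM c_spec.
have cU : J c \is a GRing.unit.
  rewrite -(unitrMr _ (rU i0)) -rmorphM c_spec /= JE; apply/j_unit.
  exact/(skew_regular_const skewS)/(skew_regular_const skewT).
have c_reg : GRing.lreg c.
  apply: mulrI0_lreg => s cs; apply: J_inj; apply: (mulrI cU).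
  by rewrite mulr0 -rmorphM cs rmorph0.
have [phi [phi_r phi_lift]] : exists phi : {lrmorphism R -> Q},
   (forall g, (exists i, g = r i) -> phi g = J g / u) /\
   (forall s, exists p : {poly R}, p.[1] = s /\ phi s = (map_poly J p).[u^-1]).
  apply: (homogenization hk deltaM c_reg hr) => [_ [i ->] //|s].
  by apply: (mulrI uU); rewrite mulVKr // mulrA uJ mulrK.
(* Both [J (r i)] and [u] pass [b] at the cost of [J c]: their quotients commute
   with it. *)
have bu : b * u = u * (b + J c) by rewrite mulrDr uJ -ub addrC subrK.
have Vub : u^-1 * b = (b + J c) * u^-1.
  by apply: (mulrI uU); rewrite mulVKr // mulrA -bu mulrK.
have uVJ s : u^-1 * J s = J s * u^-1 by apply/esym/commrV; rewrite /GRing.comm uJ.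
have phi_u s : GRing.comm u (phi s).
  apply: (comm_lrmorphism hr) => _ [i ->]; rewrite phi_r; last by exists i.
  by apply: commrM; [apply: uJ | apply: commrV].
have phi_c s : GRing.comm (J c) (phi s).
  apply: (comm_lrmorphism hr) => _ [i ->]; rewrite phi_r; last by exists i.
  by apply: commrM; [apply: JC | rewrite /GRing.comm uVJ].
have phi_b s : GRing.comm b (phi s).
  apply: (comm_lrmorphism hr) => _ [i ->]; rewrite phi_r; last by exists i.
  by rewrite /GRing.comm mulrA bJ delta_r mulrC [J (_ * _)]rmorphM -mulrDr -!mulrA Vub.
pose X := u^-1 * ((J c)^-1 * b).
have [|Phi [Phi_R Phi_x Phi_y]] := (let: And4 _ _ _ H := hA in H) Q phi X u.
  split=> [s|s|].
  - apply/commr_sym; apply: commrM; first exact/commrV/commr_sym.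
    by apply: commrM; [apply/commrV/commr_sym | apply/commr_sym].
  - exact: phi_u.
  have -> : u * X = (J c)^-1 * b by rewrite mulVKr.
  have cVu : (J c)^-1 * u = u * (J c)^-1 by apply/commr_sym/commrV/uJ.
  by rewrite -!mulrA bu [(J c)^-1 * (u * _)]mulrA cVu -mulrA mulKr // mulrDr mulVr.
exists Q, Q, j, Phi, idfun; split=> //; last by exists id.
have Phi0 s : phi s = 0 -> s = 0.
  have [p [<- ->]] := phi_lift s => p0.
  suff -> : p = 0 by rewrite horner0.
  apply: horner_invr_eq0 uU _ p0 => q.
  have -> : (map_poly J q).[u] = j (map_poly iota2 (map_poly iota1 q)).[d - iota2 a].
    rewrite -horner_map; congr (_.[_]); apply/polyP => i.
    by rewrite !coef_map /= JE.
  rewrite -(rmorph0 j) => /j_inj/(horner_subX_eq0 skewS) q0.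
  apply/polyP => i; rewrite coef0; apply: J_inj; rewrite JE.
  by rewrite -coef_map q0 coef0 !rmorph0.
apply: intermediate_order hQ _ _.
  apply: raddf_inj; apply: weyl_hom_inj hk hA _ => s.
  by rewrite Phi_R; apply: Phi0.
(* [r i = (r i / u) * u] and [a = c * u * X] lie in the image of [Phi], hence so
   does [d = u + a]. *)
have im_J s : exists z, Phi z = J s.
  elim: (hr s) => {s} [_ [i ->]|e|s t _ [z zE] _ [w wE]|s t _ [z zE] _ [w wE]].
  - exists (iota (r i) * y); rewrite rmorphM /= Phi_R Phi_y phi_r ?divrK //.
    by exists i.
  - by exists e%:A; rewrite !rmorph_alg.
  - by exists (z + w); rewrite !rmorphD /= zE wE.
  - by exists (z * w); rewrite !rmorphM /= zE wE.
have im_b : exists z, Phi z = b.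
  have [z zE] := im_J c; exists (z * (y * x)).
  by rewrite !rmorphM /= zE Phi_x Phi_y !mulVKr.
have im_T t : exists z, Phi z = j (iota2 t).
  move: t; apply: (skew_poly_ind skewT) => [s t [z zE] [w wE]|s t [z zE] [w wE]|s|//].
  - by exists (z + w); rewrite !rmorphD /= zE wE.
  - by exists (z * w); rewrite !rmorphM /= zE wE.
  by rewrite -JE.
apply: (skew_poly_ind skewS) => // [s t [z zE] [w wE]|s t [z zE] [w wE]|].
- by exists (z + w); rewrite !rmorphD /= zE wE.
- by exists (z * w); rewrite !rmorphM /= zE wE.
have [z zE] := im_b; exists (y + z).
by rewrite rmorphD /= Phi_y zE -rmorphD subrK.
Qed.
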